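(* For $m\ge 3$ define $\alpha_m=2t_{m-1}$, $\beta_m=t_m+2t_{m-3}-1$, $\gamma_m=2t_m-t_{m-1}$ and $\theta_m=\frac{3t_m+t_{m-2}-3}{2}$. Let $A(n)$ be the number of distinct squares in the prefix $\mathbb{T}[1,n]$ of the Tribonacci sequence. Then $A(n)=0$ for $n\le 7$. For $n\ge 8$, let $m$ be the positive integer such that $\alpha_m\le n<\alpha_{m+1}$; then $m\ge 3$ and $$A(n)=\begin{cases} n-\frac12(t_m+t_{m-3}+m+3), & \alpha_m\le n<\beta_m;\\ \frac12(t_m+3t_{m-3}-m-5), & \beta_m\le n<\gamma_m;\\ n-\frac12(t_{m-1}+3t_{m-2}+m+3), & \gamma_m\le n<\theta_m;\\ \frac12(2t_{m-1}+t_{m-2}+3t_{m-3}-m-6), & \text{otherwise (i.e. } \theta_m\le n<\alpha_{m+1}).\end{cases}$$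
   Context: The Tribonacci substitution $\sigma$ on the alphabet $\{a,b,c\}$ is $\sigma(a)=ab$, $\sigma(b)=ac$, $\sigma(c)=a$. The Tribonacci sequence $\mathbb{T}$ is the infinite word that is the fixed point of $\sigma$ beginning with $a$; $\mathbb{T}[1,n]$ is its prefix of length $n$ ($\mathbb{T}[1,0]$ is empty). Put $T_{-2}=\epsilon$ (empty word), $T_{-1}=c$, $T_m=\sigma^m(a)$ for $m\ge0$, $t_m=|T_m|$ for $m\ge-2$, and $t_{-3}=0$; thus $t_{-3}=t_{-2}=0$, $t_{-1}=t_0=1$, $t_1=2$, $t_2=4$, $t_3=7$, $t_4=13$, and $t_m=t_{m-1}+t_{m-2}+t_{m-3}$ for $m\ge1$. Write $u\prec v$ if $u$ is a factor (contiguous subword) of $v$. Then $A(n)=\#\{\omega \mid \omega \text{ non-empty word},\ \omega\omega\prec\mathbb{T}[1,n]\}$ for $n\ge0$. *)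

(* Defs.v *)
From HB Require Import structures.
From mathcomp Require Import all_boot all_order all_algebra.
Set Implicit Arguments.
Unset Strict Implicit.
Unset Printing Implicit Defensive.
Import Order.TTheory GRing.Theory Num.Theory.

Inductive letter : Type := la | lb | lc.

Definition letter_code (x : letter) : 'I_3 :=
  match x with
  | la => @Ordinal 3 0 isT
  | lb => @Ordinal 3 1 isT
  | lc => @Ordinal 3 2 isT
  end.

Definition letter_decode (i : 'I_3) : letter :=
  match val i with 0 => la | 1 => lb | _ => lc end.

Lemma letter_codeK : cancel letter_code letter_decode.
Proof. by case. Qed.

HB.instance Definition _ := Finite.copy letter (can_type letter_codeK).

Definition word := seq letter.

Definition sigma (x : letter) : word :=
  match x with la => [:: la; lb] | lb => [:: la; lc] | lc => [:: la] end.

Definition subst (u : word) : word := flatten (map sigma u).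

(* An infinite word is a function [w : nat -> letter], indexed from 0, so that
   [mkseq w n] is its prefix of length [n].  Since [sigma] is non-erasing,
   [sigma w = w] holds iff the image of every prefix of [w] is a prefix of
   [w]. *)
Definition sigma_fixed (w : nat -> letter) : Prop :=
  forall k, subst (mkseq w k) = mkseq w (size (subst (mkseq w k))).

Definition is_tribonacci_word (w : nat -> letter) : Prop :=
  w 0 = la /\ sigma_fixed w.

(* The words T_m for m >= -2, where [Negz k] is -(k + 1); the value [::] is
   also used below -2, so that t_(-3) = 0. *)
Definition Tword (m : int) : word :=
  match m with
  | Posz k => iter k subst [:: la]
  | Negz 0 => [:: lc]
  | Negz _ => [::]
  end.

Definition t (m : int) : nat := size (Tword m).

(* Squares are counted by their root [u]; the bound [size u <= n] built into
   the finite type [n.-bseq letter] excludes no root of a square occurring in a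
   word of length [n]. *)
Definition A (w : nat -> letter) (n : nat) : nat :=
  #|[set u : n.-bseq letter |
      (val u != [::]) && infix (val u ++ val u) (mkseq w n)]|.

Local Open Scope ring_scope.

Definition alpha (m : int) : rat := 2 * (t (m - 1))%:R.

Definition beta (m : int) : rat := (t m)%:R + 2 * (t (m - 3))%:R - 1.

Definition gamma (m : int) : rat := 2 * (t m)%:R - (t (m - 1))%:R.

Definition theta (m : int) : rat := (3 * (t m)%:R + (t (m - 2))%:R - 3) / 2.

Local Close Scope ring_scope.

Lemma subst_cat u v : subst (u ++ v) = subst u ++ subst v.
Proof. by rewrite /subst map_cat flatten_cat. Qed.

Lemma size_subst u : size u <= size (subst u).
Proof.
elim: u => //= x u IH; rewrite /subst /= size_cat -/(subst u).
by case: x => /=; rewrite ?addSn ?add0n ltnS // (leq_trans IH) ?leqW.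
Qed.

Lemma size_subst_la u : size (la :: u) < size (subst (la :: u)).
Proof. by rewrite /subst /= !ltnS size_subst. Qed.

Lemma Tword_head k : exists u, iter k subst [:: la] = la :: u.
Proof.
elim: k => [|k [u Eu]]; first by exists [::].
by rewrite iterS Eu /subst /=; exists (lb :: flatten (map sigma u)).
Qed.

Lemma size_Tword k : k < size (iter k subst [:: la]).
Proof.
elim: k => // k IH; rewrite iterS.
have [u Eu] := Tword_head k; rewrite Eu in IH *.
exact: leq_ltn_trans IH (size_subst_la u).
Qed.

Lemma prefix_subst u v : prefix u v -> prefix (subst u) (subst v).
Proof. by case/prefixP=> s ->; rewrite subst_cat prefix_prefix. Qed.

Lemma prefix_TwordS k : prefix (iter k subst [:: la]) (iter k.+1 subst [:: la]).
Proof. by elim: k => // k IH; rewrite !iterS prefix_subst. Qed.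

Lemma prefix_Tword j k : j <= k ->
  prefix (iter j subst [:: la]) (iter k subst [:: la]).
Proof.
move/subnKC <-; elim: (k - j) => [|d IH]; first by rewrite addn0 prefix_refl.
by rewrite addnS; apply: prefix_trans IH (prefix_TwordS _).
Qed.

Lemma nth_prefix (u v : word) i :
  prefix u v -> i < size u -> nth la v i = nth la u i.
Proof. by case/prefixP=> s -> lt_i; rewrite nth_cat lt_i. Qed.

Lemma tribonacci_word_exists : exists w, is_tribonacci_word w.
Proof.
pose w i := nth la (iter i subst [:: la]) i.
have wE k : prefix (mkseq w k) (iter k subst [:: la]).
  rewrite prefixE size_mkseq; apply/eqP/(@eq_from_nth _ la).
    by rewrite size_takel ?size_mkseq // ltnW ?size_Tword.
  move=> i; rewrite size_takel ?(ltnW (size_Tword _)) // => lt_ik.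
  rewrite nth_take // nth_mkseq //.
  by apply: nth_prefix (size_Tword _); apply/prefix_Tword/ltnW.
have uniqP (u v : word) k : prefix u (iter k subst [:: la]) ->
    prefix v (iter k subst [:: la]) -> size u = size v -> u = v.
  by rewrite !prefixE => /eqP {2}<- /eqP {2}<- ->.
exists w; split=> // k; set u := subst _.
have ku : k < (maxn k (size u)).+1 by rewrite ltnS leq_maxl.
apply: (uniqP _ _ (maxn k (size u)).+1); last by rewrite size_mkseq.
  apply: prefix_trans (prefix_subst (wE k)) _.
  by rewrite -iterS; apply: prefix_Tword.
apply: prefix_trans (wE _) _.
by apply: prefix_Tword; rewrite leqW ?leq_maxr.
Qed.

Lemma tribonacci_word_unique w w' :
  is_tribonacci_word w -> is_tribonacci_word w' -> w =1 w'.
Proof.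
suff H v : is_tribonacci_word v ->
    forall k, exists2 n, k < n & mkseq v n = iter k subst [:: la].
  move=> Hw Hw' i; have [n lt_in En] := H _ Hw i.
  have [n' lt_in' En'] := H _ Hw' i.
  by rewrite -(nth_mkseq la w lt_in) -(nth_mkseq la w' lt_in') En En'.
case=> v0 fix_v; elim=> [|k [n lt_kn En]].
  by exists 1; rewrite //= /mkseq /= v0.
exists (size (subst (mkseq v n))); last by rewrite -fix_v En iterS.
by rewrite En -iterS size_Tword.
Qed.

(* Main.v *)
Require Import Defs.
From mathcomp Require Import all_boot all_order all_algebra.
From mathcomp Require Import zify ring lra.
Import Order.TTheory GRing.Theory Num.Theory.

(* If w(x) = w(x + p) on an interval, then removing one level of sigma turns
   this into a match of a smaller period, because the blocks ab, ac, a have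
   distinct last letters and are told apart by their second letter.  Under sigma
   a match on the word W becomes a match on sigma(W)a.  Iterating, every match
   lies in one that is the k-fold image of an empty match: it starts at
   pos^k(y), has length at most D k = t_0 + ... + t_(k-1), spells a prefix of w,
   and its period is |sigma^k(v)| for a factor v of w at y.  Such a match is too
   short to give a square unless v is a letter, so the root of a square is a
   factor of length |sigma^k(x)| of the prefix of w of length D k, and it first
   occurs as the root of a square in the run above the first occurrence of x.
   Runs never contain fourth powers, hence distinct offsets give distinct roots.
   It turns out that at most one new square ends at each position, and those
   positions form two intervals inside [alpha_m, alpha_(m+1)). *)

(** * Lengths of the iterated images of the letters *)

Definition tn (k : nat) : nat := size (iter k subst [:: la]).

(** Since [w] is fixed by sigma, this is the index where the image of its letter at [y] begins. *)
Definition pos (w : nat -> letter) (y : nat) : nat := size (subst (mkseq w y)).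

Definition D (k : nat) : nat := \sum_(i < k) tn i.

Lemma iter_subst_cat k u v :
  iter k subst (u ++ v) = iter k subst u ++ iter k subst v.
Proof. by elim: k => //= k ->; rewrite subst_cat. Qed.

Lemma size_iter_subst_b k :
  size (iter k.+2 subst [:: lb]) = tn k + tn k.+1.
Proof.
rewrite iterSr -[subst _]/([:: la] ++ [:: lc]) iter_subst_cat size_cat addnC.
by rewrite [in X in X + _]iterSr.
Qed.

Lemma size_iter_subst_c k : size (iter k.+1 subst [:: lc]) = tn k.
Proof. by rewrite iterSr. Qed.

Lemma tnS3 k : tn k.+3 = tn k.+2 + tn k.+1 + tn k.
Proof.
rewrite {1}/tn iterSr -[subst _]/([:: la] ++ [:: lb]) iter_subst_cat size_cat.
by rewrite size_iter_subst_b addnAC addnA.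
Qed.

Lemma tn_pos k : 0 < tn k.
Proof. exact: leq_ltn_trans (size_Tword k). Qed.

Lemma tn_bounds k : [/\ 0 < tn k, tn k < tn k.+1, tn k.+1 + tn k < tn k.+2
  & tn k.+2 <= tn k.+1 + tn k.+1 + tn k].
Proof.
elim: k => [|k [h1 h2 h3 h4]]; first by [].
by split; rewrite ?tnS3; lia.
Qed.

Lemma tn_leq k l : k <= l -> tn k <= tn l.
Proof.
move/subnKC <-; elim: (l - k) => [|r IH]; first by rewrite addn0.
by have [] := tn_bounds (k + r); rewrite addnS; lia.
Qed.

Lemma DS k : D k.+1 = D k + tn k.
Proof. by rewrite /D big_ord_recr. Qed.

(** Eliminates the sum, so that later comparisons with [D] are linear in the values of [tn]. *)
Lemma D_tn k : (D k).*2 + 3 + tn k = tn k.+2.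
Proof.
elim: k => [|k IH]; first by rewrite /D big_ord0.
by rewrite DS tnS3; lia.
Qed.

(** * Blocks, desubstitution and runs in the Tribonacci word *)

Section Fixed.
Variables (w : nat -> letter) (hw : is_tribonacci_word w).

Lemma mkseq_pos y : mkseq w (pos w y) = subst (mkseq w y).
Proof. by case: hw => _ ->. Qed.

Lemma iter_posE k y : iter k (pos w) y = size (iter k subst (mkseq w y)).
Proof.
suff: mkseq w (iter k (pos w) y) = iter k subst (mkseq w y).
  by move=> <-; rewrite size_mkseq.
by elim: k => //= k <-; rewrite mkseq_pos.
Qed.

Lemma iter_posS k y :
  iter k (pos w) y.+1 = iter k (pos w) y + size (iter k subst [:: w y]).
Proof. by rewrite !iter_posE mkseqS -cats1 iter_subst_cat size_cat. Qed.

Lemma posS y : pos w y.+1 = pos w y + size (sigma (w y)).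
Proof. by have := iter_posS 1 y; rewrite /= /subst /= cats0. Qed.

Lemma pos0 : pos w 0 = 0. Proof. by []. Qed.

Lemma iter_pos0 k : iter k (pos w) 0 = 0. Proof. by elim: k => //= k ->. Qed.

Lemma nth_block y z : z < size (sigma (w y)) ->
  w (pos w y + z) = nth la (sigma (w y)) z.
Proof.
move=> hz; rewrite -(@nth_mkseq _ la w (pos w y.+1)); last first.
  by rewrite posS ltn_add2l.
rewrite mkseq_pos mkseqS -cats1 subst_cat nth_cat -/(pos w y) ltnNge leq_addr /=.
by rewrite addKn /subst /= cats0.
Qed.

Lemma w_pos y : w (pos w y) = la.
Proof. by rewrite -[pos w y]addn0 nth_block; case: (w y). Qed.

(** For the one-letter block of c, the letter read here is the first of the next block; the three
    outcomes still differ. *)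
Lemma w_pos1 y :
  w (pos w y).+1 = match w y with la => lb | lb => lc | lc => la end.
Proof.
rewrite -addn1; case E: (w y); try by rewrite nth_block E.
by rewrite (_ : _ + 1 = pos w y.+1) ?w_pos // posS E.
Qed.

Lemma pos_last y : w (pos w y.+1).-1 = last la (sigma (w y)).
Proof.
rewrite posS -[X in _ + X]prednK; last by case: (w y).
rewrite addnS /= nth_block ?prednK; try by case: (w y).
Qed.

Lemma size_sigma_bounds x : 0 < size (sigma x) <= 2.
Proof. by case: x. Qed.

Lemma pos_ltS y : pos w y < pos w y.+1.
Proof. by have /andP[] := size_sigma_bounds (w y); rewrite posS; lia. Qed.

Lemma pos_mono : {mono pos w : x y / x <= y}.
Proof. by apply: leq_mono; apply: (homo_ltn ltn_trans) => y; apply: pos_ltS. Qed.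

Lemma pos_ltmono : {mono pos w : x y / x < y}.
Proof. by move=> x y; rewrite !ltnNge pos_mono. Qed.

Lemma pos_addn y r : pos w y + r <= pos w (y + r).
Proof.
elim: r => [|r IH]; first by rewrite !addn0.
by rewrite !addnS; have := pos_ltS (y + r); lia.
Qed.

Lemma iter_pos_leq k : {homo iter k (pos w) : x y / x <= y}.
Proof. by elim: k => // k IH x y /IH /=; rewrite pos_mono. Qed.

Lemma pos_cover x : exists2 y, pos w y <= x & x < pos w y.+1.
Proof.
elim: x => [|x [y h1 h2]]; first by exists 0 => //; apply: (pos_ltS 0).
have [lt|ge] := ltnP x.+1 (pos w y.+1); first by exists y => //; lia.
by exists y.+1 => //; have := pos_ltS y.+1; lia.
Qed.

Lemma pos_of_a x : w x = la -> exists y, x = pos w y.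
Proof.
move=> wx; have [y h1 h2] := pos_cover x.
exists y; have := w_pos1 y; rewrite posS in h2; move: h2.
have [->//|ne] := eqVneq x (pos w y).
case: (w y) => /= h2; last lia.
  by rewrite (_ : (pos w y).+1 = x) ?wx //; lia.
by rewrite (_ : (pos w y).+1 = x) ?wx //; lia.
Qed.

Lemma w_not_a x : w x <> la -> w x.+1 = la.
Proof.
move=> wx; have [y h1 h2] := pos_cover x.
have ne : x != pos w y by apply/eqP=> E; apply: wx; rewrite E w_pos.
rewrite posS in h2; have := size_sigma_bounds (w y) => /andP[_ h3].
by rewrite (_ : x.+1 = pos w y.+1) ?w_pos // posS; lia.
Qed.

Definition matches p i j := forall x, i <= x < j -> w x = w (x + p).

Lemma match_block y y' : w (pos w y).+1 = w (pos w y').+1 -> w y = w y'.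
Proof. by rewrite !w_pos1; case: (w y); case: (w y'). Qed.

Lemma match_last y y' :
  w (pos w y.+1).-1 = w (pos w y'.+1).-1 -> w y = w y'.
Proof. by rewrite !pos_last; case: (w y); case: (w y'). Qed.

(** Blocks are compared from left to right while the match covers two letters from a block start.
    When it stops, at most the initial a of a block remains, whence the successor in the last
    bound. *)
Lemma desubst_right p q j y : matches p (pos w y) j ->
  pos w y + p = pos w (y + q) ->
  exists y1, [/\ y <= y1, matches q y y1 & j <= (pos w y1).+1].
Proof.
have [n] := ubnP (j - pos w y); elim: n y => // n IH y hn hm hq.
have [le|lt] := leqP j (pos w y).+1.
  by exists y; split=> // x; lia.
have E : w y = w (y + q).
  by apply: match_block; rewrite -hq -addSn; apply: hm; lia.
have lty := pos_ltS y.
case: (IH y.+1) => [||//|y1 [h1 h2 h3]]; first lia.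
- by move=> x hx; apply: hm; lia.
- by rewrite addSn !posS -E; lia.
exists y1; split=> // [|x hx]; first lia.
by have [->//|ne] := eqVneq x y; apply: h2; lia.
Qed.

(** Leftwards, the last letter of a block alone determines it, so a partly covered block already
    agrees and no extra letter arises. *)
Lemma desubst_left p q i y : matches p i (pos w y) ->
  pos w y + p = pos w (y + q) ->
  exists y0, [/\ y0 <= y, matches q y0 y, pos w y0 <= i
    & pos w y0 + p = pos w (y0 + q)].
Proof.
elim: y => [|y IH] hm hq.
  by exists 0; split=> // x.
have [le|lt] := leqP (pos w y.+1) i.
  by exists y.+1; split=> // x; lia.
have lty := pos_ltS y.
have E : w y = w (y + q).
  apply: match_last; rewrite -addSn -hq hm; last lia.
  by congr w; lia.
case: IH => [x hx||y0 [h1 h2 h3 h4]]; first by apply: hm; lia.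
  by move: hq; rewrite addSn !posS -E; lia.
exists y0; split=> // [|x hx]; first lia.
by have [->//|ne] := eqVneq x y; apply: h2; lia.
Qed.

(** Equal letters have images of equal length, so the displacement between the images stays
    constant; the additive form avoids truncated subtraction. *)
Lemma shift_match y y' d : (forall z, z < d -> w (y + z) = w (y' + z)) ->
  (forall z, z <= d -> pos w (y + z) + pos w y' = pos w (y' + z) + pos w y).
Proof.
move=> hd; elim=> [|z IH] hz; first by rewrite !addn0 addnC.
by rewrite !addnS !posS hd //; have := IH (ltnW hz); lia.
Qed.

(** The bound on [z] is inclusive: the common stretch gains the a that opens whatever block comes
    next. *)
Lemma shift_image y y' d : (forall z, z < d -> w (y + z) = w (y' + z)) ->
  forall z, pos w y + z <= pos w (y + d) -> w (pos w y + z) = w (pos w y' + z).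
Proof.
move=> hd z hz; have [v hv1 hv2] := pos_cover (pos w y + z).
have le1 : y <= v by rewrite -ltnS -pos_ltmono; lia.
have le2 : v <= y + d by rewrite -pos_mono; lia.
have hs := shift_match _ _ _ hd.
have := hs (v - y); rewrite subnKC // => /(_ ltac:(lia)) E1.
have [E|ne] := eqVneq (pos w y + z) (pos w v).
  by rewrite E (_ : _ + z = pos w (y' + (v - y))) ?w_pos //; lia.
have E : pos w y + z = (pos w v).+1.
  by rewrite posS in hv2; have := size_sigma_bounds (w v); lia.
have lt : v < y + d by rewrite -pos_ltmono; lia.
rewrite E (_ : pos w y' + z = (pos w (y' + (v - y))).+1); last by lia.
by rewrite !w_pos1 -hd ?subnKC //; lia.
Qed.

(** The case [j = 1] is the sum [D k.+1] without its first term 1, which yields [pos_D]; the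
    induction needs every [j]. *)
Lemma iter_posD k j : iter j (pos w) (D k) = \sum_(i < k) tn (i + j).
Proof.
elim: k j => [|k IH] j; first by rewrite /D !big_ord0 iter_pos0.
have -> : D k.+1 = (pos w (D k)).+1.
  rewrite -[pos w _]/(iter 1 (pos w) (D k)) IH {1}/D big_ord_recl add1n.
  by congr S; apply: eq_bigr => i _; rewrite /= addn1.
rewrite iter_posS w_pos -iterSr IH big_ord_recl addnC; congr (_ + _).
by apply: eq_bigr => i _; rewrite /= addSnnS.
Qed.

Lemma pos_D k : (pos w (D k)).+1 = D k.+1.
Proof.
rewrite -[pos w _]/(iter 1 (pos w) (D k)) iter_posD /D big_ord_recl add1n.
congr S.
by apply: eq_bigr => i _; rewrite addn1.
Qed.

(** By [shift_image] against index 0, one more sigma turns a common stretch of length [D k] into one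
    of length [pos w (D k) + 1], which is [D k.+1]. *)
Lemma iter_pos_prefix k y z : z < D k -> w (iter k (pos w) y + z) = w z.
Proof.
elim: k z => [|k IH] z; first by rewrite /D big_ord0.
rewrite -pos_D ltnS => hz; rewrite iterS.
by rewrite -(shift_image 0 (iter k (pos w) y) (D k)) // => {hz}z hz; rewrite IH.
Qed.

Lemma iter_pos_match k y q p : iter k (pos w) y + p = iter k (pos w) (y + q) ->
  matches p (iter k (pos w) y) (iter k (pos w) y + D k).
Proof.
move=> E x hx; rewrite -(subnKC (n := x) (m := iter k (pos w) y)); last by lia.
by rewrite addnAC E !iter_pos_prefix //; lia.
Qed.

Lemma no_cc x : w x = lc -> w x.+1 = la.
Proof. by move=> E; apply: w_not_a; rewrite E. Qed.

(** Strong induction on the period: an a inside the match gives aligned blocks, the match is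
    desubstituted on both sides of it, and the run found for the smaller period is lifted by one
    [pos]. *)
Lemma match_run p i j : 0 < p -> i <= j -> matches p i j ->
  exists k y q, [/\ 0 < q, iter k (pos w) y + p = iter k (pos w) (y + q),
    iter k (pos w) y <= i & j <= iter k (pos w) y + D k].
Proof.
elim/ltn_ind: p i j => p IH i j p0 ij hm.
have [E|ne] := eqVneq i j.
  by exists 0, i, p; rewrite /= E leq_addr; split.
(* If the match does not begin with a, both of its first letters are followed by a, so it can be
   extended to contain one. *)
wlog [x /andP[hx1 hx2] wx] : j ij hm ne / exists2 x, i <= x < j & w x = la.
  move=> H; case E: (w i == la).
    by apply: H => //; exists i; [lia | apply/eqP].
  have wi : w i <> la by move/eqP: E.
  have wip : w (i + p) <> la by rewrite -hm //; lia.
  case: (H (maxn j i.+2)) => [|x hx|||k [y [q [? ? ? ?]]]]; try lia.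
  - have [lt|ge] := ltnP x j; first by apply: hm; lia.
    by rewrite (_ : x = i.+1) 1?addSn ?w_not_a //; lia.
  - by exists i.+1; [lia | apply: w_not_a].
  by exists k, y, q; split=> //; lia.
have [y Ey] := pos_of_a _ wx; subst x.
have := hm _ ltac:(apply/andP; split; [exact: hx1|exact: hx2]).
rewrite w_pos => /esym/pos_of_a[y' Ey'].
have lty : y < y' by rewrite -pos_ltmono; lia.
have [q q0 Eq] : exists2 q, 0 < q & y' = y + q.
  by exists (y' - y); lia.
subst y'.
have [lt|ge] := ltnP q p.
  case: (desubst_right p q j y) => // [x hx|y1 [hy1 m1 j1]].
    by apply: hm; lia.
  case: (desubst_left p q i y) => // [x hx|y0 [hy0 m0 i0 e0]].
    by apply: hm; lia.
  case: (IH q lt y0 y1) => // [|x hx|k [z [r [r0 er z0 z1]]]].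
  - lia.
  - by have [ltx|gex] := ltnP x y; [apply: m0; lia | apply: m1; lia].
  exists k.+1, z, r; split=> //=; first last.
  - apply: leq_trans j1 _; rewrite -pos_D.
    have := @shift_match (iter k (pos w) z) 0 (D k) _ (D k) (leqnn _).
    rewrite add0n pos0 addn0 => Ek.
    rewrite -(addnC (pos w (D k)).+1) addSn ltnS -Ek ?pos_mono //.
    by move=> v hv; rewrite iter_pos_prefix.
  - by apply: leq_trans i0; rewrite pos_mono.
  (* The displacement [p], known at [y0], is carried back to the start of the run, where the letters
     agree by [iter_pos_prefix]. *)
  rewrite -er.
  have := @shift_match (iter k (pos w) z) (iter k (pos w) z + q) (D k) _
           (y0 - iter k (pos w) z).
  rewrite addnAC subnKC // => H.
  have := H _ _; rewrite -e0.
  move=> /(_ _ ltac:(lia)) H'; have := H' _.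
  suff: forall v, v < D k -> w (iter k (pos w) z + v) = w (iter k (pos w) z + q + v).
    by move=> /H'; lia.
  by move=> v hv; rewrite er !iter_pos_prefix.
(* Removing sigma did not shorten the period, so w[y, y+q) consists of c's
   and q = 1. *)
have wy : w y = lc.
  have : pos w y.+1 + q <= p + (pos w y).+1.
    have := pos_addn y.+1 q.-1; rewrite addSnnS prednK // -Ey'; lia.
  by rewrite posS; case: (w y) => //=; lia.
have q1 : q = 1.
  have wy1 := no_cc _ wy.
  case: q q0 Ey' ge {lty} => [|[|q]] // _ Ey' ge; exfalso.
  have := pos_addn y.+2 q; rewrite -addSnnS -addSnnS in Ey' *.
  by rewrite -Ey' !posS wy wy1 /=; lia.
move: Ey'; rewrite q1 addn1 posS wy /= => /addnI p1.
(* The block of c followed by the next initial a spells aa, a run of level 1 with [D 1 = 1]. *)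
exists 1, y, 1; rewrite addn1 /= posS wy p1 /=; split=> //.
- have [//|lt] := leqP (pos w y) i.
  have hx : i <= (pos w y).-1 < j by lia.
  have y0 : 0 < y by case: (y) lt => //; rewrite pos0.
  have := hm _ hx; rewrite p1 addn1 prednK; last by lia.
  rewrite w_pos -(prednK y0) pos_last.
  case E: (w y.-1) => //= _.
  by have := no_cc _ E; rewrite prednK // wy.
- rewrite DS /D big_ord0 add0n -[tn 0]/1.
  have [//|lt] := leqP j (pos w y + 1).
  have := hm (pos w y.+1); rewrite p1 addn1 w_pos w_pos1 (no_cc _ wy) => H.
  by have // := H ltac:(rewrite posS wy /=; lia).
Qed.

End Fixed.

(** * Parameters of squares, and passage from lists to indices *)

Lemma tn_double k : tn k.+1 <= (tn k).*2.
Proof.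
case: k => [|[|k]] //; rewrite tnS3.
by have [] := tn_bounds k; lia.
Qed.

Lemma tn_leD k : tn k <= (D k).+1.
Proof.
elim: k => // k IH; rewrite DS.
by have := tn_double k; lia.
Qed.

Lemma tnS k : tn k.+1 = tn k + size (iter k subst [:: lb]).
Proof.
by rewrite /tn iterSr -[subst _]/([:: la] ++ [:: lb]) iter_subst_cat size_cat.
Qed.

Lemma size_iter_subst_ge k x :
  size (iter k subst [:: lc]) <= size (iter k subst [:: x]).
Proof.
case: k => [|[|k]]; [by [] | by case: x |].
rewrite size_iter_subst_c; case: x.
- by rewrite -/(tn _) tn_leq.
- by rewrite size_iter_subst_b leq_addl.
- by rewrite size_iter_subst_c.
Qed.

(* e is the length of the shortest prefix containing the square with root
   w[o, o + p).  The three cases come from runs above the first a (at 0), the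
   first c (at 3) and the first b (at 1).  The runs above a and c share their
   periods, so the second case only has the offsets beyond those of the first.
   The level k corresponds to m = k + 3. *)
Definition new_square_at (k e p o : nat) : Prop :=
  [\/ [/\ p = tn k.+2, e = (tn k.+2).*2 + o & o + tn k.+2 <= D k.+2],
      [/\ p = tn k, e = tn k.+1 + tn k.+2 + (tn k).*2 + o,
          D k < o + tn k & o < tn k] |
      [/\ p = tn k + tn k.+1, e = tn k.+2 + (tn k + tn k.+1).*2 + o & o <= D k]].

Definition new_square (e p o : nat) : Prop := exists k, new_square_at k e p o.

Definition window (w : nat -> letter) (o p : nat) : word :=
  mkseq (fun z => w (o + z)) p.

Lemma eq_window w o o' p :
  window w o p = window w o' p <-> forall z, z < p -> w (o + z) = w (o' + z).
Proof.
split=> [E z hz|E].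
  by rewrite -(nth_mkseq la (fun z => w (o + z)) hz) -/(window w o p) E nth_mkseq.
apply: (@eq_from_nth _ la); first by rewrite !size_mkseq.
move=> z; rewrite !size_mkseq // => hz.
by rewrite !nth_mkseq ?E.
Qed.

Lemma infix_squareP (w : nat -> letter) (u : word) n :
  reflect (exists i p, [/\ 0 < p, i + p.*2 <= n, matches w p i (i + p)
                         & u = window w i p])
    ((u != [::]) && infix (u ++ u) (mkseq w n)).
Proof.
apply: (iffP andP) => [[u0 h]|[i [p [p0 hn hm ->]]]].
  have [s [s' E]] : exists s s' : word, mkseq w n = s ++ (u ++ u) ++ s'.
    by case/infixP: h => s [s' E]; exists s, s'.
  have szE := congr1 size E; rewrite !size_cat size_mkseq in szE.
  have nthE z : z < size u -> w (size s + z) = nth la u z /\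
                              w (size s + z + size u) = nth la u z.
    move=> hz; rewrite -!(@nth_mkseq _ la w n); try lia.
    have nE v : v < size (u ++ u) ->
        nth la (s ++ (u ++ u) ++ s') (size s + v) = nth la (u ++ u) v.
      by move=> hv; rewrite [LHS]nth_cat ltnNge leq_addr /= addKn [LHS]nth_cat hv.
    rewrite E -addnA !nE ?size_cat ?nth_cat ?hz; try lia.
    by rewrite ltnNge leq_addl /= addnK.
  exists (size s); exists (size u); split.
  - by case: (u) u0.
  - by lia.
  - move=> x hx; have [] := nthE (x - size s) ltac:(lia).
    by rewrite subnKC => [-> ->|]; [|lia].
  apply: (@eq_from_nth _ la) => [|z hz]; first by rewrite size_mkseq.
  rewrite nth_mkseq //.
  by have [] := nthE _ hz.
split; first by case: (p) p0.
apply/infixP; exists (mkseq w i), (mkseq (fun z => w (i + p.*2 + z)) (n - (i + p.*2))).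
apply: (@eq_from_nth _ la) => [|z].
  by rewrite !size_cat !size_mkseq; lia.
rewrite size_mkseq => hz; rewrite !nth_cat !size_cat !size_mkseq.
case: ifP => h1; first by rewrite !nth_mkseq.
case: ifP => h2.
  case: ifP => h3; rewrite !nth_mkseq; try lia.
    by congr w; lia.
  by rewrite -[RHS]/(w _) [RHS]hm; [congr w; lia|lia].
by rewrite !nth_mkseq; [congr w; lia|lia..].
Qed.

(** * Classification of squares by the runs containing them *)

Section Squares.
Variables (w : nat -> letter) (hw : is_tribonacci_word w).

(** Of two consecutive letters one is a, and the k-fold images of a and of any letter together are
    longer than [D k]. *)
Lemma run_period k y q p : 0 < q ->
  iter k (pos w) y + p = iter k (pos w) (y + q) ->
  (q = 1 /\ p = size (iter k subst [:: w y])) \/ D k < p.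
Proof.
case: q => [//|[|q]] _.
  by rewrite addn1 iter_posS // => /addnI ->; left.
have := iter_pos_leq w hw k y.+2 (y + q.+2) ltac:(lia).
rewrite !iter_posS // => h1 h2; right.
suff : D k < size (iter k subst [:: w y]) + size (iter k subst [:: w y.+1]) by lia.
have hD : D k < tn k + size (iter k subst [:: lc]).
  case: (k) => [|l]; first by rewrite /D big_ord0.
  rewrite size_iter_subst_c; have := D_tn l.+1; have := tnS3 l.
  by have [] := tn_bounds l; lia.
have [wy|wy] := eqVneq (w y) la.
  rewrite wy -/(tn k); apply: leq_trans hD _.
  by rewrite leq_add2l size_iter_subst_ge.
rewrite (w_not_a w hw y) -/(tn k); last by apply/eqP.
by rewrite addnC; apply: leq_trans hD _; rewrite leq_add2l size_iter_subst_ge.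
Qed.

(** The run containing the match has period at least the length of the k-fold image of c, and three
    times that length exceeds [D k]. *)
Lemma no_fourth_power p i : 0 < p -> ~ matches w p i (i + 3 * p).
Proof.
move=> p0 hm; have [|k [y [q [q0 e hi hj]]]] := match_run w hw _ _ _ p0 _ hm.
  by lia.
have [[q1 Ep]|] := run_period _ _ _ _ q0 e; last lia.
have := size_iter_subst_ge k (w y); rewrite -Ep.
case: k {e Ep} hi hj => [|k]; first by rewrite /D big_ord0; lia.
rewrite size_iter_subst_c => hi hj; have := D_tn k.+1; have := tnS3 k.
by have [] := tn_bounds k; have := tn_double k; lia.
Qed.

Lemma w0 : w 0 = la. Proof. by case: hw. Qed.
Lemma w1 : w 1 = lb. Proof. by rewrite (w_pos1 w hw 0) w0. Qed.
Lemma pos1 : pos w 1 = 2. Proof. by rewrite posS // w0. Qed.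
Lemma w2 : w 2 = la. Proof. by rewrite -pos1 w_pos. Qed.
Lemma w3 : w 3 = lc. Proof. by have := w_pos1 w hw 1; rewrite pos1 w1. Qed.

Lemma iter_pos_1 k : iter k (pos w) 1 = tn k.
Proof. by rewrite iter_posS // iter_pos0 w0. Qed.

Lemma iter_pos_3 k : iter k (pos w) 3 = tn k + tn k.+1.
Proof. by rewrite !iter_posS // iter_pos0 w0 w1 w2 -/(tn k) tnS; lia. Qed.

(** The run spells a prefix of [w], so the root can be read at offset [o] of [w] itself, and the
    start of [w] inherits the period. *)
Lemma period_occ k y p o : p = size (iter k subst [:: w y]) -> o + p <= D k ->
  [/\ matches w p (iter k (pos w) y + o) (iter k (pos w) y + o + p),
      forall z, z < p -> w (iter k (pos w) y + o + z) = w (o + z) &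
      forall z, z < o -> w z = w (z + p)].
Proof.
move=> Ep ho.
have hm : matches w p (iter k (pos w) y) (iter k (pos w) y + D k).
  by apply: (iter_pos_match w hw k y 1); rewrite addn1 iter_posS // Ep.
split=> [x hx|z hz|z hz].
- by apply: hm; lia.
- by rewrite -addnA iter_pos_prefix //; lia.
- rewrite -(iter_pos_prefix w hw k y z); last lia.
  rewrite hm; last lia.
  by rewrite -addnA iter_pos_prefix //; lia.
Qed.

Lemma new_square_lt e p o : new_square e p o -> o < p.
Proof.
case=> k [[-> _]|[-> _ _]|[-> _]] //.
  by have := D_tn k.+2; have := tnS3 k.+1; have := tnS3 k; have [] := tn_bounds k; lia.
by have := D_tn k; have [] := tn_bounds k; lia.
Qed.

(** The runs have level [k.+2] above 0, [k.+1] above 3 and [k.+2] above 1; they start at 0,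
    [tn k.+1 + tn k.+2] and [tn k.+2]. *)
Lemma new_square_occ e p o : new_square e p o -> exists i,
  [/\ i + p.*2 = e, matches w p i (i + p),
      forall z, z < p -> w (i + z) = w (o + z) &
      forall z, z < o -> w z = w (z + p)].
Proof.
case=> k [[Ep Ee ho]|[Ep Ee _ ho]|[Ep Ee ho]].
- have [|h1 h2 h3] := period_occ k.+2 0 p o _ ltac:(rewrite Ep; exact: ho).
    by rewrite w0 Ep.
  rewrite iter_pos0 add0n in h1 h2.
  by exists o; split=> //; lia.
- have hD : o + p <= D k.+1.
    by rewrite DS Ep; have := tn_leD k; lia.
  have [|h1 h2 h3] := period_occ k.+1 3 p o _ hD.
    by rewrite w3 size_iter_subst_c.
  exists (iter k.+1 (pos w) 3 + o); split=> //.
  by rewrite iter_pos_3; lia.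
- have hD : o + p <= D k.+2 by rewrite !DS; lia.
  have [|h1 h2 h3] := period_occ k.+2 1 p o _ hD.
    by rewrite w1 size_iter_subst_b.
  exists (iter k.+2 (pos w) 1 + o); split=> //.
  by rewrite iter_pos_1; lia.
Qed.

Lemma new_square_complete i p : 0 < p -> matches w p i (i + p) ->
  exists e o, [/\ e <= i + p.*2, new_square e p o & window w i p = window w o p].
Proof.
move=> p0 hm; have [|k [y [q [q0 e hi hj]]]] := match_run w hw _ _ _ p0 _ hm.
  exact: leq_addr.
have [[q1 Ep]|] := run_period _ _ _ _ q0 e; last lia.
subst q; rewrite addn1 in e.
have [o Eo] : exists o, i = iter k (pos w) y + o.
  by exists (i - iter k (pos w) y); lia.
have ho : o + p <= D k by lia.
have [_ h2 h3] := period_occ _ _ _ _ Ep ho; rewrite -Eo in h2.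
(* At levels 0 and 1 the image of a is longer than the run, so a square needs level at least 2. *)
have a_case l o' : p = tn l -> o' + p <= D l ->
    exists k, l = k.+2 /\ new_square (p.*2 + o') p o'.
  case: l => [|[|l]] -> ho'.
  - by move: ho'; rewrite /D big_ord0; have := tn_pos 0; lia.
  - by move: ho'; rewrite DS /D big_ord0 -[tn 1]/2 -[tn 0]/1; lia.
  by exists l; split=> //; exists l; apply: Or31.
case wy: (w y) Ep.
- rewrite -/(tn k) => Ep; have [l [El hs]] := a_case _ _ Ep ho.
  by exists (p.*2 + o), o; split=> //; [lia | apply/eq_window].
- case: k hi hj {h2 h3} e Eo ho => [|[|k]] hi hj e Eo ho Ep.
  + by move: ho; rewrite /D big_ord0; lia.
  + by move: ho; rewrite Ep /= DS /D big_ord0; have := tn_pos 0; rewrite /tn /=; lia.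
  rewrite size_iter_subst_b in Ep.
  have y1 : 1 <= y by case: (y) wy => //; rewrite w0.
  have := iter_pos_leq w hw k.+2 _ _ y1; rewrite iter_pos_1 => hy.
  exists (tn k.+2 + p.*2 + o), o; split; first lia.
    by exists k; apply: Or33; split=> //; [rewrite Ep | move: ho; rewrite !DS; lia].
  apply/eq_window => z hz; rewrite Eo -addnA iter_pos_prefix //; lia.
- case: k hi hj h2 h3 e Eo ho => [|k] hi hj h2 h3 e Eo ho Ep.
    by move: ho; rewrite /D big_ord0; lia.
  rewrite size_iter_subst_c in Ep.
  have y3 : 3 <= y.
    by case: (y) wy => [|[|[|]]] //; rewrite ?w0 ?w1 ?w2.
  have := iter_pos_leq w hw k.+1 _ _ y3; rewrite iter_pos_3 => hy.
  (* The run is shorter than three periods, so removing at most one period brings the offset below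
     [p] without changing the root. *)
  have [r [hr1 hr2 hr3]] : exists r, [/\ r < p, r <= o & window w i p = window w r p].
    have [lt|ge] := ltnP o p.
      by exists o; split=> //; apply/eq_window.
    exists (o - p); split; [|lia|].
      have := D_tn k.+1; have := tnS3 k; have [] := tn_bounds k.
      by have := tn_double k; lia.
    apply/eq_window => z hz; rewrite h2 //.
    have [lt|ge'] := ltnP (o - p + z) o; last by lia.
    by rewrite (h3 (o - p + z)) //; congr w; lia.
  (* The run of level [k] above index 0 has the same period [tn k]; a root that fits there occurs
     earlier. *)
  have [le|gt] := leqP (r + p) (D k).
    have [l [El hs]] := a_case _ _ Ep le.
    by exists (p.*2 + r), r; split=> //; lia.
  exists (tn k.+1 + tn k.+2 + p.*2 + r), r; split=> //; first lia.
  by exists k; apply: Or32; split=> //; rewrite -Ep.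
Qed.

(** Equal windows would give the periodic extension of the root also the periods [o' - o] and
    [p - (o' - o)]. The smaller is at most half of [p], so the square would contain a fourth
    power. *)
Lemma windows_distinct e p o o' : new_square e p o' -> o < o' ->
  window w o p <> window w o' p.
Proof.
move=> hs lt /eq_window E; have o'p := new_square_lt _ _ _ hs.
have [i [_ hm hi hper]] := new_square_occ _ _ _ hs.
have p0 : 0 < p by lia.
pose v z := w (o' + z %% p).
have vw x : x < p.*2 -> w (i + x) = v x.
  move=> hx; rewrite /v; have [ltx|gex] := ltnP x p.
    by rewrite modn_small // hi.
  rewrite -(subnK gex) modnDr modn_small; last lia.
  by rewrite addnA -hm ?hi //; lia.
have vp z : v (z + p) = v z by rewrite /v modnDr.
pose d := o' - o.
have vd0 z : z < p -> v (z + d) = v z.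
  move=> hz; rewrite /v (modn_small hz).
  have [ltz|gez] := ltnP (z + d) p.
    by rewrite modn_small // -E //; congr w; lia.
  rewrite -(subnK gez) modnDr modn_small; last lia.
  rewrite -E; last lia.
  (* The index is [o' + z - p], below [o'], where the start of [w] has period [p]. *)
  by rewrite [LHS]hper /d; [congr w; lia | lia].
have vd z : v (z + d) = v z.
  rewrite {1}/v -modnDml -/(v _) vd0 ?ltn_mod //.
  by rewrite /v modn_mod.
have vpd z : v (z + (p - d)) = v z.
  by rewrite -(vd (z + (p - d))) -addnA subnK ?vp //; lia.
have [f [f0 hf vf]] : exists f, [/\ 0 < f, f.*2 <= p & forall z, v (z + f) = v z].
  have [le|gt] := leqP d.*2 p; first by exists d; split=> //; lia.
  by exists (p - d); split=> //; lia.
apply: (no_fourth_power f i f0) => x hx.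
have := vw (x - i) ltac:(lia); have := vw (x - i + f) ltac:(lia).
by rewrite vf addnA subnKC; [move=> -> -> | lia].
Qed.

(** Equal windows force equal periods and offsets. These determine [e]: no [tn k] is a sum of two
    consecutive values, and for a common period the first two cases have disjoint offsets. *)
Lemma new_square_inj e e' p p' o o' : new_square e p o -> new_square e' p' o' ->
  window w o p = window w o' p' -> e = e'.
Proof.
move=> hs hs' E.
have Ep : p = p' by have := congr1 size E; rewrite !size_mkseq.
subst p'.
have Eo : o = o'.
  have [lt|gt|//] := ltngtP o o'.
    by case: (windows_distinct _ _ _ _ hs' lt).
  by case: (windows_distinct _ _ _ _ hs gt).
subst o'.
have lt_tn k l : k < l -> tn k < tn l.
  by move=> kl; apply: leq_trans (tn_leq _ _ kl); have [] := tn_bounds k.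
have tn_inj k l : tn k = tn l -> k = l.
  by move=> Et; have [/lt_tn|/lt_tn|//] := ltngtP k l; rewrite Et ltnn.
have tn_sum k l : tn k <> tn l + tn l.+1.
  move=> Et; have [b1 b2 b3 b4] := tn_bounds l.
  have [le|gt] := leqP k l.+1; first by have := tn_leq _ _ le; lia.
  by have := tn_leq _ _ gt; lia.
have tn_sum_inj k l : tn k + tn k.+1 = tn l + tn l.+1 -> k = l.
  move=> Et; have [kl|kl|//] := ltngtP k l.
    by have := lt_tn _ _ kl; have := lt_tn k.+1 l.+1 kl; lia.
  by have := lt_tn _ _ kl; have := lt_tn l.+1 k.+1 kl; lia.
case: hs => k [[E1 E2 E3]|[E1 E2 E3 E4]|[E1 E2 E3]];
case: hs' => l [[F1 F2 F3]|[F1 F2 F3 F4]|[F1 F2 F3]];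
 rewrite {}E1 in F1 *; try by [case: (tn_sum _ _ F1)|case: (tn_sum _ _ (esym F1))].
- by lia.
- by move: (tn_inj _ _ F1) => El; subst l; lia.
- by move: (tn_inj _ _ F1) => El; subst k; lia.
- by move: (tn_inj _ _ F1) => El; subst k; lia.
- by move: (tn_sum_inj _ _ F1) => El; subst k; lia.
Qed.

Lemma new_squareP u n :
  reflect (exists e p o, [/\ e <= n, new_square e p o & u = window w o p])
    ((u != [::]) && infix (u ++ u) (mkseq w n)).
Proof.
apply: (iffP (infix_squareP _ _ _)) => [[i [p [p0 hn hm ->]]]|].
  have [e [o [he hs E]]] := new_square_complete _ _ p0 hm.
  by exists e, p, o; split=> //; lia.
case=> e [p [o [he hs ->]]]; have [i [Ei hm hi _]] := new_square_occ _ _ _ hs.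
exists i, p; split=> //; [by have := new_square_lt _ _ _ hs; lia | lia |].
by apply/eq_window => z hz; rewrite hi.
Qed.

(** The type of bounded sequences depends on [n]; plain lists allow different [n] to be compared. *)
Lemma card_A n (s : seq word) : uniq s ->
  (forall u, u \in s = (u != [::]) && infix (u ++ u) (mkseq w n)) ->
  A w n = size s.
Proof.
move=> us hs; rewrite /A cardE -(size_map val).
apply/perm_size/uniq_perm => //.
  by rewrite map_inj_uniq ?enum_uniq //; apply: val_inj.
move=> u; rewrite hs; apply/mapP/idP => [[v]|].
  by rewrite mem_enum inE => h ->.
move=> h; have hu : size u <= n.
  have [i [p [_ hi _ ->]]] := infix_squareP _ _ _ h.
  by rewrite size_mkseq; lia.
by exists (Bseq hu); rewrite // mem_enum inE.
Qed.

Lemma enum_A n : exists s : seq word, uniq s /\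
  forall u, u \in s = (u != [::]) && infix (u ++ u) (mkseq w n).
Proof.
exists [seq val u | u : n.-bseq letter in
  [set u : n.-bseq letter | (val u != [::]) && infix (val u ++ val u) (mkseq w n)]].
split; first by rewrite map_inj_uniq ?enum_uniq //; apply: val_inj.
move=> u; apply/mapP/idP => [[v]|].
  by rewrite mem_enum inE => h ->.
move=> h; have hu : size u <= n.
  have [i [p [_ hi _ ->]]] := infix_squareP _ _ _ h.
  by rewrite size_mkseq; lia.
by exists (Bseq hu); rewrite // mem_enum inE.
Qed.

End Squares.

(** * End positions of new squares, level by level *)

Lemma new_square_at_bounds k e p o : new_square_at k e p o ->
  (tn k.+2).*2 <= e < (tn k.+3).*2.
Proof.
have := D_tn k; have [] := tn_bounds k; have := tn_leD k.
rewrite tnS3 => bD b1 b2 b3 b4 ED.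
by case=> [[_ Ee]|[_ Ee]|[_ Ee]]; rewrite ?DS; lia.
Qed.

Lemma level_inj k l n : (tn k.+2).*2 <= n < (tn k.+3).*2 ->
  (tn l.+2).*2 <= n < (tn l.+3).*2 -> k = l.
Proof.
move=> hk hl; have [lt|gt|//] := ltngtP k l.
  by have := tn_leq k.+3 l.+2 lt; lia.
by have := tn_leq l.+3 k.+2 gt; lia.
Qed.

Lemma new_square_unique e p o p' o' :
  new_square e p o -> new_square e p' o' -> p = p' /\ o = o'.
Proof.
move=> [k hk] [l hl].
have El := level_inj _ _ _ (new_square_at_bounds _ _ _ _ hk)
  (new_square_at_bounds _ _ _ _ hl).
subst l; have := D_tn k; have [b1 b2 b3 b4] := tn_bounds k; have := tn_leD k.
by case: hk => [[Ep Ee]|[Ep Ee]|[Ep Ee]];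
   case: hl => [[Fp Fe]|[Fp Fe]|[Fp Fe]]; rewrite ?DS; lia.
Qed.

(** The first case ends at [tn k.+2 + D k.+2] and the second begins just after it, so they merge
    into one interval; the third case is the other. *)
Lemma new_squareE k e : (tn k.+2).*2 <= e < (tn k.+3).*2 ->
  (exists p o, new_square e p o) <->
  (e < tn k.+1 + tn k.+2 + 3 * tn k) \/
  (tn k.+2 + (tn k + tn k.+1).*2 <= e <= tn k.+2 + (tn k + tn k.+1).*2 + D k).
Proof.
move=> he; have := D_tn k; have [b1 b2 b3 b4] := tn_bounds k; have bD := tn_leD k.
have b5 := tn_double k; move=> ED; split=> [[p [o [l hl]]]|].
  have El := level_inj _ _ _ he (new_square_at_bounds _ _ _ _ hl); subst l.
  by case: hl => [[_ Ee]|[_ Ee]|[_ Ee]]; rewrite ?DS; lia.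
case=> [lt|/andP[h1 h2]].
  have [le|gt] := leqP e (tn k.+2 + D k.+2).
    by exists (tn k.+2), (e - (tn k.+2).*2), k; apply: Or31; split=> //; lia.
  move: gt; rewrite !DS => gt.
  exists (tn k), (e - (tn k.+1 + tn k.+2 + (tn k).*2)), k.
  by apply: Or32; split=> //; lia.
exists (tn k + tn k.+1), (e - (tn k.+2 + (tn k + tn k.+1).*2)), k.
by apply: Or33; split=> //; lia.
Qed.

(** * Counting the end positions up to [n] *)

Section Count.
Variables (w : nat -> letter) (hw : is_tribonacci_word w).

(** By [new_square_inj] the root was not counted before, and by [new_square_unique] it is the only
    addition. *)
Lemma A_new n p o : new_square n.+1 p o -> A w n.+1 = (A w n).+1.
Proof.
move=> hs; have [s [us hin]] := enum_A w n.
rewrite (card_A w n s us hin).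
apply: (@card_A w n.+1 (window w o p :: s)) => [|u].
  rewrite /= us andbT hin; apply/negP => /(new_squareP w hw _ _).
  case=> e [p' [o' [he hs' E]]].
  by have := new_square_inj w hw _ _ _ _ _ _ hs hs' E; lia.
rewrite inE hin; apply/idP/(new_squareP w hw).
  case/orP => [/eqP ->|/(new_squareP w hw)[e [p' [o' [he hs' E]]]]].
    by exists n.+1, p, o.
  by exists e, p', o'; split=> //; lia.
case=> e [p' [o' [he hs' E]]]; apply/orP.
move: he; rewrite leq_eqVlt => /orP[/eqP Ee|lt].
  by subst e; have [-> ->] := new_square_unique _ _ _ _ _ hs hs'; left; apply/eqP.
by right; apply/(new_squareP w hw); exists e, p', o'.
Qed.

Lemma A_old n : ~ (exists p o, new_square n.+1 p o) -> A w n.+1 = A w n.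
Proof.
move=> hs; have [s [us hin]] := enum_A w n.
rewrite (card_A w n s us hin); apply: (@card_A w n.+1 s us) => u.
rewrite hin; apply/(new_squareP w hw)/(new_squareP w hw).
  by case=> e [p [o [he hs' E]]]; exists e, p, o; split=> //; lia.
case=> e [p [o [he hs' E]]]; exists e, p, o; split=> //.
have [Ee|//] : e = n.+1 \/ e <= n by lia.
by case: hs; exists p, o; rewrite -Ee.
Qed.

Lemma A_increasing a b : a <= b ->
  (forall e, a < e <= b -> exists p o, new_square e p o) -> A w b = A w a + (b - a).
Proof.
move/subnKC => <-; elim: (b - a) => [|d IH] h; first by rewrite addn0 subnn addn0.
have [|p [o hs]] := h (a + d).+1; first lia.
rewrite addnS (A_new _ _ _ hs) IH; first lia.
by move=> e he; apply: h; lia.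
Qed.

Lemma A_constant a b : a <= b ->
  (forall e, a < e <= b -> ~ exists p o, new_square e p o) -> A w b = A w a.
Proof.
move/subnKC => <-; elim: (b - a) => [|d IH] h; first by rewrite addn0.
rewrite addnS A_old ?IH // => [e he|]; apply: h; lia.
Qed.

Lemma A_small n : n < 8 -> A w n = 0.
Proof.
move=> hn; apply: (@card_A w n [::]) => // u; apply/esym/negP.
move/(new_squareP w hw) => [e [p [o [he [k hk] _]]]].
have := new_square_at_bounds _ _ _ _ hk; have := tn_leq 2 k.+2 isT.
by rewrite -[tn 2]/4; lia.
Qed.

(** Each truncated difference counts the end positions up to [n] in one interval of [new_squareE]: 0
    before it, its full length after it. *)
Lemma A_level k n : (tn k.+2).*2 <= n < (tn k.+3).*2 ->
  A w n = A w (tn k.+2).*2.-1 +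
    (minn n.+1 (tn k.+1 + tn k.+2 + 3 * tn k) - (tn k.+2).*2) +
    (minn n.+1 (tn k.+2 + (tn k + tn k.+1).*2 + (D k).+1)
       - (tn k.+2 + (tn k + tn k.+1).*2)).
Proof.
move=> hn; have ED := D_tn k; have [b1 b2 b3 b4] := tn_bounds k.
have bD := tn_leD k; have b5 := tn_double k; have ES := tnS3 k.
set al := (tn k.+2).*2 in hn *.
set be := tn k.+1 + _ + _; set ga := tn k.+2 + _.
have h1 m : al <= m < be -> A w m = A w al.-1 + (m.+1 - al).
  move=> hm; rewrite (A_increasing al.-1 m); [lia | lia |] => e he.
  by apply/(new_squareE k); lia.
have h2 m : be <= m < ga -> A w m = A w be.-1.
  move=> hm; apply: A_constant; first lia.
  by move=> e he /(new_squareE k e ltac:(lia)); lia.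
have h3 m : ga <= m < ga + (D k).+1 -> A w m = A w ga.-1 + (m.+1 - ga).
  move=> hm; rewrite (A_increasing ga.-1 m); [lia | lia |] => e he.
  by apply/(new_squareE k); lia.
have h4 m : ga + (D k).+1 <= m < (tn k.+3).*2 -> A w m = A w (ga + D k).
  move=> hm; apply: A_constant; first lia.
  by move=> e he /(new_squareE k e ltac:(lia)); lia.
have o1 : al < be by lia.
have o2 : be < ga by lia.
have o3 : ga + (D k).+1 <= (tn k.+3).*2 by lia.
case/andP: hn => hn1 hn2; clear ED b1 b2 b3 b4 bD b5 ES.
have E1 : A w be.-1 = A w al.-1 + (be - al) by rewrite h1 ?prednK //; lia.
have E2 : A w ga.-1 = A w al.-1 + (be - al) by rewrite h2 // -?E1 //; lia.
have E3 : A w (ga + D k) = A w al.-1 + (be - al) + (D k).+1.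
  by rewrite h3 -?E2 -?addnS ?addKn //; lia.
have [c1|c1] := ltnP n be.
  rewrite h1 ?hn1 // (minn_idPl c1) (minn_idPl _); last lia.
  by rewrite (_ : n.+1 - ga = 0) ?addn0 //; lia.
rewrite [minn n.+1 be](minn_idPr _); last by lia.
have [c2|c2] := ltnP n ga.
  rewrite h2 ?c1 // E1 (minn_idPl _); last lia.
  by rewrite (_ : n.+1 - ga = 0) ?addn0 //; lia.
have [c3|c3] := ltnP n (ga + (D k).+1).
  by rewrite h3 ?c2 // E2 (minn_idPl _).
by rewrite h4 ?c3 // E3 (minn_idPr _) ?addKn //; lia.
Qed.

(** The number of squares found before level [k], doubled and rearranged to avoid division and
    subtraction. The induction step is [A_level] at the last [n] of a level. *)
Lemma A_base k :
  (A w (tn k.+2).*2.-1).*2 + tn k.+1 + (tn k).*2 + k + 8 = 3 * tn k.+2.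
Proof.
elim: k => [|k IH]; first by rewrite A_small.
have ED := D_tn k; have [b1 b2 b3 b4] := tn_bounds k.
have bD := tn_leD k; have b5 := tn_double k; have ES := tnS3 k.
by rewrite (A_level k); lia.
Qed.

End Count.

(** * From levels to the rational thresholds and formulas *)

Lemma level_exists n : 8 <= n ->
  exists k, (tn k.+2).*2 <= n < (tn k.+3).*2.
Proof.
move=> hn; have ex : exists k, (tn k.+2).*2 <= n by exists 0.
have bd k : (tn k.+2).*2 <= n -> k <= n.
  by have := size_Tword k.+2; rewrite -/(tn _); lia.
case: (ex_maxnP ex bd) => k hk kmax; exists k; rewrite hk ltnNge.
by apply/negP => /kmax; rewrite ltnn.
Qed.

Local Open Scope ring_scope.

Lemma alphaS (k : nat) : alpha k.+1 = ((tn k).*2)%:R.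
Proof.
by rewrite /alpha (_ : k.+1%:Z - 1 = k); [rewrite -mul2n natrM | lia].
Qed.

Lemma betaE (k : nat) :
  beta k.+3 = (tn k.+1 + tn k.+2 + 3 * tn k).-1%N%:R.
Proof.
rewrite /beta (_ : k.+3%:Z - 3 = k); last by lia.
rewrite -[t k.+3]/(tn k.+3) -[t k]/(tn k) tnS3 -subn1 natrB; last first.
  by have := tn_pos k; lia.
by rewrite !natrD; ring.
Qed.

Lemma gammaE (k : nat) : gamma k.+3 = (tn k.+2 + (tn k + tn k.+1).*2)%N%:R.
Proof.
rewrite /gamma (_ : k.+3%:Z - 1 = k.+2); last by lia.
rewrite -[t k.+3]/(tn k.+3) -[t k.+2]/(tn k.+2) tnS3.
by rewrite -mul2n !natrD; ring.
Qed.

Lemma thetaE (k : nat) :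
  theta k.+3 = (tn k.+2 + (tn k + tn k.+1).*2 + D k)%N%:R.
Proof.
rewrite /theta (_ : k.+3%:Z - 2 = k.+1); last by lia.
rewrite -[t k.+3]/(tn k.+3) -[t k.+1]/(tn k.+1) tnS3.
have := congr1 (fun z => z%:R : rat) (D_tn k).
by rewrite -!mul2n !natrD => E; lra.
Qed.

Lemma alpha_levelP (m : int) (n : nat) : (8 <= n)%N -> 0 < m ->
  alpha m <= n%:R < alpha (m + 1) ->
  exists k : nat, m = k.+3 /\ ((tn k.+2).*2 <= n < (tn k.+3).*2)%N.
Proof.
move=> hn; case: m => // -[//|k] _.
rewrite (_ : k.+1%:Z + 1 = k.+2); last by lia.
rewrite !alphaS ler_nat ltr_nat.
(* For [m] equal to 1 or 2 the upper bound is 4 or 8, against [8 <= n]. *)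
case: k => [|[|k]]; [by rewrite -[tn 1]/2%N; lia | by rewrite -[tn 2]/4%N; lia |].
by exists k.
Qed.

Theorem theoremA (w : nat -> letter) (hw : is_tribonacci_word w) :
  (forall n : nat, (n <= 7)%N -> A w n = 0%N) /\
  (forall n : nat, (8 <= n)%N ->
     (exists! m : int, 0 < m /\ alpha m <= n%:R < alpha (m + 1)) /\
     (forall m : int, 0 < m -> alpha m <= n%:R < alpha (m + 1) ->
        3 <= m /\
        (A w n)%:R =
          if alpha m <= n%:R < beta m then
            n%:R - ((t m)%:R + (t (m - 3))%:R + m%:~R + 3) / 2
          else if beta m <= n%:R < gamma m then
            ((t m)%:R + 3 * (t (m - 3))%:R - m%:~R - 5) / 2
          else if gamma m <= n%:R < theta m then
            n%:R - ((t (m - 1))%:R + 3 * (t (m - 2))%:R + m%:~R + 3) / 2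
          else
            (2 * (t (m - 1))%:R + (t (m - 2))%:R + 3 * (t (m - 3))%:R
               - m%:~R - 6) / 2 :> rat)).
Proof.
split=> [n hn|n hn]; first exact: A_small.
split=> [|m m0 hm].
  have [k hk] := level_exists n hn; exists k.+3%:Z; split.
    rewrite (_ : k.+3%:Z + 1 = k.+4); last by lia.
    by rewrite !alphaS ler_nat ltr_nat.
  move=> m [m0 hm]; have [l [-> hl]] := alpha_levelP m n hn m0 hm.
  by rewrite (level_inj _ _ _ hk hl).
have [k [-> hk]] := alpha_levelP m n hn m0 hm; split; first by lia.
rewrite betaE gammaE thetaE alphaS !ler_nat !ltr_nat.
rewrite (_ : k.+3%:Z - 1 = k.+2); last by lia.
rewrite (_ : k.+3%:Z - 2 = k.+1); last by lia.
rewrite (_ : k.+3%:Z - 3 = k); last by lia.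
rewrite -![t (Posz _)]/(tn _) -pmulrn.
have := A_level w hw k n hk; have := A_base w hw k; have := tnS3 k.
have := D_tn k; have [b1 b2 b3 b4] := tn_bounds k; have b5 := tn_double k.
set N := A w n; set B := A w _.
move: (tn k) (tn k.+1) (tn k.+2) (tn k.+3) (D k) N B hk b1 b2 b3 b4 b5.
move=> a b c d e N B /andP[hk hk'] b1 b2 b3 b4 b5 hD hd hB hN; rewrite hk /=.
(* Doubled, with subtracted terms moved across, each case is an identity between naturals; [cast]
   carries it to the rationals. *)
have cast (x y : nat) : x = y -> x%:R = y%:R :> rat by move->.
(* [beta] is the last end position of its interval, not one past it: there the count has already
   reached its plateau. The same holds for [theta]. *)
have [c1|c1] := ltnP n (b + c + 3 * a).-1.
  have /cast : (2 * N + d + a + k + 6 = 2 * n)%N by lia.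
  by rewrite !natrD => ? /=; lra.
have [c2|c2] := ltnP n (c + (a + b).*2).
  have /cast : (2 * N + k + 8 = d + 3 * a)%N by lia.
  by rewrite !natrD => ? /=; lra.
have [c3|c3] := ltnP n (c + (a + b).*2 + e).
  have /cast : (2 * N + c + 3 * b + k + 6 = 2 * n)%N by lia.
  by rewrite !natrD => ? /=; lra.
have /cast : (2 * N + k + 9 = 2 * c + b + 3 * a)%N by lia.
by rewrite !natrD => ? /=; lra.
Qed.
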